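(* Let $n\ge 1$ and let $w_1,\ldots,w_n$ be positive real numbers with $\sum_{j=1}^n w_j\ge 1$. For every $j=1,\ldots,n$ let $\{b_{j,k}:k\ge 0\}$ be a sequence in $\mathcal B=\mathcal B_1\cup\mathcal B_2\cup\mathcal B_3$ (classes defined in the context). Let $b_0:=1$ and $b_k:=\sum_{j=1}^n w_jb_{j,k}$ for $k\ge 1$. Then the sequence $\{b_k:k\ge 0\}$ satisfies $b_k\ge 1$ for all $k\ge 0$, is unbounded, and the set $\{k\ge 0:b_k=1\}$ is finite. Also, $\lim_{k\to\infty}b_k^{1/k}=1$. Consequently, for every power series $f(\theta)=\sum_{k=0}^\infty a_k\theta^k$ with $a_k>0$ for all $k\ge 0$ and positive radius of convergence, the sequence $\{b_k:k\ge 0\}$ satisfies the following condition (A) with respect to $f$: $\{b_k\}$ is unbounded, $b_0=1$, $b_k\ge 1$ for all $k\ge 1$, the set $\{k\ge 0:b_k=1\}$ is finite, and the power series $\sum_{k=0}^{\infty}b_k^2a_k\theta^k$ has positive radius of convergence.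
   Context: A positive radius of convergence may be $+\infty$. For $\gamma>0$ put $t(\gamma,0)=1$ and $t(\gamma,k)=\dfrac{\gamma(\gamma+1)\cdots(\gamma+k-1)}{k!}$ for $k\ge 1$. The classes of real sequences $\{c_k:k\ge 0\}$ are as follows; in each, $m\ge 1$ is an integer and $v_1,\ldots,v_m$ are positive real numbers with $\sum_{j=1}^m v_j\ge 1$. $\mathcal B_1$: all sequences with $c_0=1$ and $c_k=\sum_{j=1}^m v_jk^{p_j}$ for $k\ge 1$, where $p_j>0$ for all $j$. $\mathcal B_2$: all sequences with $c_0=1$ and $c_k=\sum_{j=1}^m v_j\,t(\beta_j,k)/t(\alpha_j,k)$ for $k\ge 1$, where $0<\alpha_j<\beta_j$ for all $j$. $\mathcal B_3$: all sequences with $c_0=1$ and $c_k=\sum_{j=1}^m v_j\log p_j(k)$ for $k\ge 1$, where each $p_j$ is a non-constant polynomial with all coefficients non-negative (real) and $p_j(1)\ge e$. *)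

(* Defs.v *)
From mathcomp Require Import all_boot all_order all_algebra.
From mathcomp Require Import all_classical all_reals all_analysis.
Set Implicit Arguments.
Unset Strict Implicit.
Unset Printing Implicit Defensive.
Import Order.TTheory GRing.Theory Num.Theory.
Import numFieldNormedType.Exports.
Local Open Scope classical_set_scope.
Local Open Scope ring_scope.

(* t(gamma, k) = gamma (gamma + 1) ... (gamma + k - 1) / k!, with
   t(gamma, 0) = 1 given by the empty product. *)
Definition rising_ratio (R : realType) (gamma : R) (k : nat) : R :=
  (\prod_(i < k) (gamma + i%:R)) / k`!%:R.

Definition weights (R : realType) (m : nat) (v : 'I_m -> R) : Prop :=
  [/\ (0 < m)%N, forall j, 0 < v j & 1 <= \sum_(j < m) v j].

Definition class_B1 (R : realType) : set (R^nat) :=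
  [set c | exists (m : nat) (v p : 'I_m -> R),
    [/\ weights v,
        forall j, 0 < p j,
        c 0%N = 1
      & forall k, (0 < k)%N -> c k = \sum_(j < m) v j * k%:R `^ p j]].

Definition class_B2 (R : realType) : set (R^nat) :=
  [set c | exists (m : nat) (v alpha beta : 'I_m -> R),
    [/\ weights v,
        forall j, 0 < alpha j /\ alpha j < beta j,
        c 0%N = 1
      & forall k, (0 < k)%N ->
          c k = \sum_(j < m) v j * (rising_ratio (beta j) k / rising_ratio (alpha j) k)]].

(* [size p] is the degree plus one, so [1 < size p] means non-constant. *)
Definition class_B3 (R : realType) : set (R^nat) :=
  [set c | exists (m : nat) (v : 'I_m -> R) (p : 'I_m -> {poly R}),
    [/\ weights v,
        forall j, [/\ (1 < size (p j))%N, forall i, 0 <= (p j)`_i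
                    & expR 1 <= (p j).[1]],
        c 0%N = 1
      & forall k, (0 < k)%N -> c k = \sum_(j < m) v j * ln (p j).[k%:R]]].

Definition class_B (R : realType) : set (R^nat) :=
  @class_B1 R `|` @class_B2 R `|` @class_B3 R.

(* An extended real: the radius may be +oo. The set contains 0, so the supremum
   is nonnegative. *)
Definition cvg_radius (R : realType) (a : R^nat) : \bar R :=
  ereal_sup [set `|x|%:E | x in [set x : R | cvgn (pseries a x)]].

(* Condition (A) for b with respect to the power series with coefficients a. *)
Definition condition_A (R : realType) (a b : R^nat) : Prop :=
  [/\ ~ bounded_fun b,
      b 0%N = 1,
      forall k, (1 <= k)%N -> 1 <= b k,
      finite_set [set k | b k = 1]
    & (0 < cvg_radius (fun k => (b k ^+ 2 * a k)%R))%E].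

(* Main.v *)
(** Call [g] tame when [1 <= g k] and [g k <= C k^N] for [k >= 1] and [g] tends
    to [+oo]. Each elementary term [k^p], [t(beta, k) / t(alpha, k)] and
    [log p(k)] is tame, and tameness passes to weighted sums with total weight at
    least 1; applied twice, this makes [b] tame. Since [k^N = O(q^k)] for every
    [q > 1], a tame sequence has k-th root tending to 1 and multiplying
    coefficients by its square keeps the radius of convergence positive. *)

Require Import Defs.
From mathcomp Require Import all_boot all_order all_algebra.
From mathcomp Require Import all_classical all_reals all_analysis.
From mathcomp Require Import ring lra.
Set Implicit Arguments.
Unset Strict Implicit.
Import Order.TTheory GRing.Theory Num.Theory.
Import numFieldNormedType.Exports.
Local Open Scope classical_set_scope.
Local Open Scope ring_scope.

(** * Bernoulli's inequality, weighted sums of tame sequences, and geometric bounds *)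

Lemma Bernoulli_ge (R : realDomainType) (h : R) (N : nat) :
  0 <= h -> 1 + N%:R * h <= (1 + h) ^+ N.
Proof.
move=> h0; elim: N => [|N IHN]; first by rewrite mul0r addr0 expr0.
rewrite exprS; apply: (le_trans _ (ler_wpM2l _ IHN)); last by lra.
have : 0 <= N%:R * (h * h) by rewrite mulr_ge0 ?ler0n ?mulr_ge0.
rewrite -natr1; nra.
Qed.

(** Both bounds leave out index 0: the class formulas hold for [k >= 1] only, and [0 ^+ N] vanishes
    for [N > 0]. *)
Record tame_growth (R : realType) (g : R^nat) : Prop := TameGrowth {
  tame_ge1 : forall k, (0 < k)%N -> 1 <= g k;
  tame_cvgy : g k @[k --> \oo] --> +oo;
  tame_poly : exists (C : R) (N : nat),
    forall k, (0 < k)%N -> g k <= C * k%:R ^+ N }.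

Lemma tame_growth_sum (R : realType) (m : nat) (v : 'I_m -> R)
    (g : 'I_m -> R^nat) (c : R^nat) :
  weights v -> (forall j, tame_growth (g j)) ->
  (forall k, (0 < k)%N -> c k = \sum_(j < m) v j * g j k) ->
  tame_growth c.
Proof.
move=> [m0 v0 v1] tg cE; split.
- move=> k k0; rewrite cE//; apply: (le_trans v1); apply: ler_sum => j _.
  by rewrite ler_peMr ?(ltW (v0 j))// (tame_ge1 (tg j)).
(* A single summand suffices: once [g j k >= A / v j] it pushes the sum past [A], the others being
   nonnegative. *)
- apply/cvgryPge => A; pose j := Ordinal m0.
  have /cvgryPge/(_ (A / v j)) gA := tame_cvgy (tg j).
  near=> k.
  have k0 : (0 < k)%N by near: k; exact: nbhs_infty_gt.
  rewrite cE// (bigD1 j)//= -[leLHS]addr0; apply: lerD.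
    by rewrite mulrC -ler_pdivrMr ?v0//; near: k.
  apply: sumr_ge0 => i _; apply: mulr_ge0; first exact/ltW/v0.
  exact: le_trans ler01 (tame_ge1 (tg i) k0).
- have /choice[C] := fun j => tame_poly (tg j).
  move=> /choice[N gC].
  (* The sum of the exponents dominates each of them. Evaluating at [k = 1] gives [1 <= C j], hence
     the sign of [C j]. *)
  exists (\sum_j v j * C j), (\sum_j N j)%N => k k0.
  rewrite cE// mulr_suml; apply: ler_sum => j _; rewrite -mulrA.
  apply: ler_wpM2l; first exact/ltW/v0.
  apply: (le_trans (gC j k k0)); apply: ler_wpM2l.
    by have := le_trans (tame_ge1 (tg j) (ltn0Sn 0)) (gC j 1%N isT);
       rewrite expr1n mulr1; lra.
  by rewrite ler_weXn2l ?ler1n// (bigD1 j)//= leq_addr.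
Unshelve. all: by end_near. Qed.

(** With [r] the [N.+1]-th root of [q], Bernoulli gives [k * (r - 1) <= r ^+ k]; raise this to the
    power [N.+1]. The root of index [N.+1] also covers [N = 0]. *)
Lemma poly_le_geometric (R : realType) (N : nat) (q : R) : 1 < q ->
  exists2 C : R, 0 < C & forall k, (0 < k)%N -> k%:R ^+ N <= C * q ^+ k.
Proof.
move=> q1; pose r := q `^ N.+1%:R^-1.
have q0 : 0 <= q by lra.
have rq : r ^+ N.+1 = q.
  by rewrite -powR_mulrn ?powR_ge0// -powRrM mulVf ?pnatr_eq0// powRr1.
have r1 : 1 < r.
  have -> : 1 = 1 `^ N.+1%:R^-1 :> R by rewrite powR1.
  by rewrite gt0_ltr_powR ?invr_gt0 ?ltr0n// nnegrE.
have h0 : 0 < r - 1 by lra.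
exists ((r - 1)^-1 ^+ N.+1); first by rewrite exprn_gt0 ?invr_gt0.
move=> k k0; apply: (@le_trans _ _ (k%:R ^+ N.+1)).
  by rewrite ler_weXn2l ?ler1n.
rewrite -rq -exprM mulnC exprM -exprMn; apply: lerXn2r; rewrite ?nnegrE//.
  by rewrite mulr_ge0 ?invr_ge0 ?exprn_ge0//; lra.
rewrite mulrC ler_pdivlMr//.
have := @Bernoulli_ge R (r - 1) k (ltW h0).
by rewrite (_ : 1 + (r - 1) = r); [lra | ring].
Qed.

(** * Tameness of the elementary terms and of the three classes *)

Lemma tame_growth_powR (R : realType) (p : R) : 0 < p ->
  tame_growth (fun k => k%:R `^ p).
Proof.
move=> p0; split.
- move=> k k0; rewrite -[leLHS](@powRr0 R k%:R).
  by rewrite ler_powR ?ler1n// ltW.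
- apply/cvgryPge => A; near=> k.
  (* Cutting [A] off at 0 makes it a [p]-th power. *)
  have A0 : 0 <= Num.max A 0 by rewrite le_max lexx orbT.
  apply: (@le_trans _ _ (Num.max A 0)); first by rewrite le_max lexx.
  have -> : Num.max A 0 = (Num.max A 0 `^ p^-1) `^ p.
    by rewrite -powRrM mulVf ?gt_eqF// powRr1.
  apply: ge0_ler_powR; rewrite ?nnegrE ?powR_ge0//; first exact: ltW.
  by near: k; exact: (cvgry_ge cvgr_idn).
- exists 1, (Num.Def.trunc p).+1 => k k0.
  by rewrite mul1r -powR_mulrn// ler_powR ?ler1n// ltW// truncnS_gt.
Unshelve. all: by end_near. Qed.

Lemma rising_ratio_div (R : realType) (alpha beta : R) (k : nat) :
  0 < alpha ->
  rising_ratio beta k / rising_ratio alpha k =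
  \prod_(i < k) (1 + (beta - alpha) / (alpha + i%:R)).
Proof.
move=> a0; rewrite /rising_ratio.
have fk : k`!%:R != 0 :> R by rewrite pnatr_eq0 -lt0n fact_gt0.
have ai i : alpha + i%:R != 0 by rewrite gt_eqF// ltr_wpDr.
rewrite invf_div mulrA divfK// -prodf_div; apply: eq_bigr => i _.
by field; apply: ai.
Qed.

(** Each factor is [(alpha + i + 1) / (alpha + i)]. *)
Lemma telescope_prod (R : realType) (alpha : R) (k : nat) : 0 < alpha ->
  \prod_(i < k) (1 + (alpha + i%:R)^-1) = (alpha + k%:R) / alpha.
Proof.
move=> a0; elim: k => [|k IHk].
  by rewrite big_ord0 addr0 divff// gt_eqF.
rewrite big_ord_recr/= IHk -natr1; field.
by rewrite !gt_eqF// ltr_wpDr.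
Qed.

(* With [d = beta - alpha] and [x = 1 / (alpha + i)], Bernoulli's inequality
   compares [1 + d x] with powers of [1 + x], whose product telescopes:
   [1 + x <= (1 + d x) ^+ N] when [1 <= N d], and
   [1 + d x <= (1 + x) ^+ N] when [d <= N]. *)
Lemma tame_growth_rising_ratio (R : realType) (alpha beta : R) :
  0 < alpha -> alpha < beta ->
  tame_growth (fun k => rising_ratio beta k / rising_ratio alpha k).
Proof.
move=> a0 ab; have d0 : 0 < beta - alpha by lra.
have x0 i : 0 < (alpha + i%:R)^-1 by rewrite invr_gt0 ltr_wpDr.
have ge1 k : 1 <= rising_ratio beta k / rising_ratio alpha k.
  rewrite rising_ratio_div//.
  elim/big_ind : _ => //[y z|i _]; first by nra.
  by rewrite lerDl ltW// mulr_gt0.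
split => //.
- apply/cvgryPge => A; pose N := (Num.Def.trunc (beta - alpha)^-1).+1.
  have Nd : 1 <= N%:R * (beta - alpha).
    by rewrite -ler_pdivrMr// div1r ltW// truncnS_gt.
  (* The [N]-th power of the ratio is at least [(alpha + k) / alpha], which exceeds [A' ^+ N] once
     [k >= A' ^+ N * alpha]. *)
  near=> k; pose A' := Num.max A 1.
  have A1 : 1 <= A' by rewrite le_max lexx orbT.
  apply: (@le_trans _ _ A'); first by rewrite le_max lexx.
  rewrite -(@ler_pXn2r _ N)// ?nnegrE; try by [lra|exact: le_trans ler01 (ge1 k)].
  apply: (@le_trans _ _ ((alpha + k%:R) / alpha)).
    rewrite ler_pdivlMr//; apply: (@le_trans _ _ k%:R); last lra.
    by near: k; exact: (cvgry_ge cvgr_idn).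
  rewrite -telescope_prod// rising_ratio_div// -prodrXl; apply: ler_prod => i _.
  have xi := x0 i; apply/andP; split; first lra.
  apply: le_trans (@Bernoulli_ge R _ N _); last by rewrite ltW// mulr_gt0.
  by rewrite mulrA lerD2l ler_peMl// ltW.
- pose N := (Num.Def.trunc (beta - alpha)).+1.
  have dN : beta - alpha <= N%:R by rewrite ltW// truncnS_gt.
  (* For [k >= 1], [(alpha + k) / alpha = 1 + k / alpha <= (1 + alpha^-1) * k]. *)
  exists ((1 + alpha^-1) ^+ N), N => k k0.
  have ai0 : 0 < alpha^-1 by rewrite invr_gt0.
  have k1 : 1 <= k%:R :> R by rewrite ler1n.
  apply: (@le_trans _ _ (((alpha + k%:R) / alpha) ^+ N)).
    rewrite -telescope_prod// rising_ratio_div// -prodrXl.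
    apply: ler_prod => i _; have xi := x0 i; apply/andP; split.
      by rewrite addr_ge0// ltW// mulr_gt0.
    apply: le_trans (Bernoulli_ge _ _); last exact: ltW.
    by rewrite lerD2l ler_wpM2r// ltW.
  rewrite -exprMn; apply: lerXn2r; rewrite ?nnegrE ?mulr_ge0//; try lra.
  by rewrite mulrDl divff ?gt_eqF//; nra.
Unshelve. all: by end_near. Qed.

Lemma tame_growth_ln_poly (R : realType) (p : {poly R}) :
  (1 < size p)%N -> (forall i, 0 <= p`_i) -> expR 1 <= p.[1] ->
  tame_growth (fun k => ln p.[k%:R]).
Proof.
move=> sp p0 p1.
have ge_p1 k : (0 < k)%N -> p.[1] <= p.[k%:R].
  move=> k0; rewrite !horner_coef; apply: ler_sum => i _.
  by rewrite ler_wpM2l// expr1n exprn_ege1// ler1n.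
have p1_gt0 : 0 < p.[1] by apply: lt_le_trans p1; exact: expR_gt0.
have pk_gt0 k : (0 < k)%N -> 0 < p.[k%:R].
  by move=> k0; exact: lt_le_trans (ge_p1 k k0).
split.
- move=> k k0; rewrite -[leLHS](@expRK R) ler_ln ?posrE ?expR_gt0 ?pk_gt0//.
  exact: le_trans (ge_p1 k k0).
- have sE : size p = (size p).-1.+1 by rewrite prednK// ltnW.
  have lp0 : 0 < lead_coef p.
    rewrite lt_neqAle eq_sym lead_coef_eq0 -size_poly_gt0 (ltnW sp)/=.
    by rewrite lead_coefE p0.
  apply/cvgryPge => A; near=> k.
  have k0 : (0 < k)%N by near: k; exact: nbhs_infty_gt.
  rewrite -[leLHS](@expRK R) ler_ln ?posrE ?expR_gt0 ?pk_gt0//.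
  (* The leading term alone is enough, since the degree is at least 1. *)
  apply: (@le_trans _ _ (lead_coef p * k%:R)).
    rewrite mulrC -ler_pdivrMr//.
    by near: k; exact: (cvgry_ge cvgr_idn).
  rewrite horner_coef sE big_ord_recr/= -lead_coefE -[leLHS]add0r.
  apply: lerD.
    by apply: sumr_ge0 => i _; rewrite mulr_ge0// exprn_ge0.
  rewrite ler_pM2l// -[leLHS]expr1 ler_weXn2l ?ler1n//.
  by rewrite -ltnS -sE.
(* [ln y < y], and each monomial satisfies [k ^+ i <= k ^+ size p]. *)
- exists p.[1], (size p) => k k0.
  apply: (le_trans (ltW (ln_sublinear (pk_gt0 k k0)))).
  rewrite !horner_coef mulr_suml; apply: ler_sum => i _.
  by rewrite expr1n mulr1 ler_wpM2l// ler_weXn2l ?ler1n// ltnW.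
Unshelve. all: by end_near. Qed.

Lemma class_B_tame_growth (R : realType) (c : R^nat) :
  class_B c -> tame_growth c.
Proof.
case=> [[|]|].
- move=> [m [v [p [wv p0 _ cE]]]].
  by apply: (tame_growth_sum wv _ cE) => j; exact: tame_growth_powR.
- move=> [m [v [alpha [beta [wv ab _ cE]]]]].
  apply: (tame_growth_sum wv _ cE) => j; have [? ?] := ab j.
  exact: tame_growth_rising_ratio.
- move=> [m [v [p [wv hp _ cE]]]].
  apply: (tame_growth_sum wv _ cE) => j; have [? ? ?] := hp j.
  exact: tame_growth_ln_poly.
Qed.

(** * Consequences of tameness *)

Lemma tame_growth_unbounded (R : realType) (b : R^nat) :
  tame_growth b -> ~ bounded_fun b.
Proof.
move=> tb [M [_ bM]].
have /cvgryPgt/(_ (M + 1)) [K _ /(_ K (leqnn K))/= bK] := tame_cvgy tb.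
have /(_ K I)/= := bM (M + 1) (ltr_pwDr ltr01 (lexx M)).
by rewrite leNgt (lt_le_trans bK)// ler_norm.
Qed.

Lemma tame_growth_finite1 (R : realType) (b : R^nat) :
  tame_growth b -> finite_set [set k | b k = 1].
Proof.
move=> tb; have /cvgryPgt/(_ 1) [K _ bK] := tame_cvgy tb.
apply: (@sub_finite_set _ _ `I_K); last exact: finite_II.
move=> k /= bk1; rewrite ltnNge; apply/negP => Kk.
by have := bK k Kk; rewrite /= bk1 ltxx.
Qed.

Lemma tame_growth_root (R : realType) (b : R^nat) :
  tame_growth b -> b k `^ (k%:R^-1) @[k --> \oo] --> (1 : R).
Proof.
move=> tb; apply/cvgrPdist_le => e e0.
have q1 : 1 < 1 + e by lra.
have [C [N bC]] := tame_poly tb.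
have [D D0 kD] := poly_le_geometric N.+1 q1.
have C0 : 0 < C.
  have := le_trans (tame_ge1 tb (ltn0Sn 0)) (bC 1%N isT).
  by rewrite expr1n mulr1; lra.
near=> k.
have k0 : (0 < k)%N by near: k; exact: nbhs_infty_gt.
have kr0 : 0 < k%:R :> R by rewrite ltr0n.
have b1 := tame_ge1 tb k0.
have b0 : 0 <= b k by lra.
have bq : b k <= (1 + e) ^+ k.
  (* The spare factor [k], gained by using the exponent [N.+1], absorbs the constant [C * D] as soon
     as [k >= C * D]. *)
  rewrite -(ler_pM2r kr0); apply: (@le_trans _ _ (C * k%:R ^+ N.+1)).
    by rewrite exprSr mulrA ler_pM2r// bC.
  apply: (@le_trans _ _ (C * D * (1 + e) ^+ k)).
    by rewrite -mulrA ler_pM2l// kD.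
  rewrite mulrC ler_pM2l ?exprn_gt0//; last lra.
  by near: k; exact: (cvgry_ge cvgr_idn).
have ge1 : 1 <= b k `^ k%:R^-1.
  by rewrite -[leLHS](@powRr0 R (b k)) ler_powR// invr_ge0 ltW.
rewrite distrC ger0_norm ?subr_ge0// lerBlDl.
have -> : 1 + e = ((1 + e) ^+ k) `^ k%:R^-1.
  rewrite -powR_mulrn; last lra.
  by rewrite -powRrM divff ?gt_eqF// powRr1//; lra.
by apply: ge0_ler_powR; rewrite ?nnegrE ?invr_ge0 ?exprn_ge0//; lra.
Unshelve. all: by end_near. Qed.

(** A tame sequence is [O(2 ^+ k)], so its square costs at most a factor 4 in the argument of the
    power series. *)
Lemma tame_growth_radius (R : realType) (a b : R^nat) :
  tame_growth b -> (0 < cvg_radius a)%E ->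
  (0 < cvg_radius (fun k => (b k ^+ 2 * a k)%R))%E.
Proof.
move=> tb /ereal_sup_gt[_ [x xa <-]]; rewrite lte_fin => x0.
have [C [N bC]] := tame_poly tb.
have [D D0 kD] := @poly_le_geometric R N 2 (ltr1n R 2).
have C0 : 0 < C.
  have := le_trans (tame_ge1 tb (ltn0Sn 0)) (bC 1%N isT).
  by rewrite expr1n mulr1; lra.
(* Halving puts [z] strictly inside the disc, where convergence is absolute; dividing by 4
   compensates [4 ^+ k]. *)
pose z := `|x| / 2; pose y := z / 4.
have y0 : 0 < y by rewrite !divr_gt0.
have zx : `|z| < `|x| by rewrite ger0_norm /z; lra.
have /= za := is_cvg_pseries_inside_norm xa zx.
(* The maximum with the norm of [b 0] covers index 0, which tameness does not control. *)
pose E := (Num.max `|b 0%N| (C * D)) ^+ 2.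
have bE k : b k ^+ 2 <= E * 4 ^+ k.
  have -> : 4 ^+ k = (2 ^+ k) ^+ 2 :> R.
    by rewrite -exprM mulnC exprM; congr (_ ^+ _); ring.
  rewrite /E -exprMn -[leLHS]real_normK ?num_real//.
  apply: lerXn2r; rewrite ?nnegrE ?mulr_ge0 ?exprn_ge0//.
    by rewrite le_max normr_ge0.
  case: k => [|k]; first by rewrite expr0 mulr1 le_max lexx.
  rewrite ger0_norm; last exact: le_trans ler01 (tame_ge1 tb (ltn0Sn k)).
  apply: (le_trans (bC k.+1 isT)).
  apply: (@le_trans _ _ (C * D * 2 ^+ k.+1)); first by rewrite -mulrA ler_pM2l// kD.
  by rewrite ler_wpM2r ?exprn_ge0// le_max lexx orbT.
apply: (@lt_le_trans _ _ `|y|%:E); first by rewrite lte_fin normr_gt0 gt_eqF.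
apply: ereal_sup_ubound; exists y => //=.
apply: normed_cvg => /=.
apply: (@series_le_cvg _ _ (fun k => E * (`|a k| * z ^+ k))) => //=.
- move=> k; rewrite mulr_ge0 ?sqr_ge0// mulr_ge0// exprn_ge0//.
  by rewrite /z divr_ge0.
- move=> k; rewrite 2!normrM (ger0_norm (sqr_ge0 _)).
  rewrite (ger0_norm (exprn_ge0 _ (ltW y0))).
  have -> : z = 4 * y by rewrite /y; field.
  rewrite [(4 * y) ^+ k]exprMn [`|a k| * _]mulrCA (mulrA E) -mulrA.
  by rewrite ler_wpM2r// mulr_ge0 ?exprn_ge0 ?(ltW y0).
- exact: (@is_cvg_seriesZ _ _ E za).
Qed.

Unset Implicit Arguments.
Set Strict Implicit.

Theorem theorem3 (R : realType) (n : nat) (w : 'I_n -> R)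
    (bs : 'I_n -> R^nat) (b : R^nat)
    (hn : (1 <= n)%N)
    (hw : forall j, 0 < w j)
    (hw1 : 1 <= \sum_(j < n) w j)
    (hbs : forall j, class_B (bs j))
    (hb0 : b 0%N = 1)
    (hb : forall k, (1 <= k)%N -> b k = \sum_(j < n) w j * bs j k) :
  (forall k, 1 <= b k) /\
  ~ bounded_fun b /\
  finite_set [set k | b k = 1] /\
  b k `^ (k%:R^-1) @[k --> \oo] --> (1 : R) /\
  (forall a : R^nat, (forall k, 0 < a k) -> (0 < cvg_radius a)%E ->
     condition_A a b).
Proof.
have tb : tame_growth b.
  (* Second use of closure under weighted sums: the first gave tameness of each [bs j]. *)
  apply: (@tame_growth_sum R n w bs) => // j.
  exact: class_B_tame_growth.
have unb := tame_growth_unbounded tb.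
have fin1 := tame_growth_finite1 tb.
split; [|split; [|split; [|split]]] => //.
- by case=> [|k]; [rewrite hb0 | exact: tame_ge1].
- exact: tame_growth_root.
- move=> a _ ra; split => //; first exact: tame_ge1.
  exact: tame_growth_radius.
Qed.
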